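(* Let $(X,\mu)$ be a standard probability space and let $T\in\mathrm{Aut}(X,\mu)$ be ergodic. Then $[T]_1$ is generated (as a group) by the set $\mathrm{Per}([T]_1)\cup\mathrm{Ind}([T]_1)$, where $\mathrm{Per}([T]_1)$ is the set of periodic elements of $[T]_1$ and $\mathrm{Ind}([T]_1)$ is its set of transformations induced by $T$.
   Context: A standard probability space $(X,\mu)$ is a standard Borel space with a non-atomic Borel probability measure. $\mathrm{Aut}(X,\mu)$ is the group of measure-preserving Borel bijections of $X$ modulo a.e. equality. $T$ is ergodic if every Borel set which is a union of $T$-orbits has measure $0$ or $1$ (then a.e. orbit is infinite). Set $[T]=\{U\in\mathrm{Aut}(X,\mu): U(x)\in\{T^n(x):n\in\mathbb Z\}\text{ for a.e. }x\}$; each $U\in[T]$ has a cocycle $c_U:X\to\mathbb Z$ defined by $U(x)=T^{c_U(x)}(x)$, and the $\mathrm L^1$ full group is $[T]_1=\{U\in[T]:\int_X|c_U|\,d\mu<+\infty\}$. An element is periodic if (almost) all its orbits are finite. For a Borel set $A\subseteq X$ of positive measure, the transformation $T_A$ induced by $T$ on $A$ is defined by $T_A(x)=T^{n_A(x)}(x)$ for $x\in A$, where $n_A(x)$ is the least $n\geq1$ with $T^n(x)\in A$, and $T_A(x)=x$ for $x\notin A$; $\mathrm{Ind}([T]_1)$ is the set of all such $T_A$ (they all belong to $[T]_1$). *)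

(* Defs.v *)
From HB Require Import structures.
From mathcomp Require Import all_boot all_order all_algebra.
From mathcomp Require Import all_classical all_reals all_analysis.

Set Implicit Arguments.
Unset Strict Implicit.
Unset Printing Implicit Defensive.
Import Order.TTheory GRing.Theory Num.Theory.
Local Open Scope classical_set_scope.
Local Open Scope ring_scope.

(** The measurable sets of [X] are, up to a bijection, the Borel sets of a
    separable complete metric space. *)
Definition standard_Borel (R : realType) d (X : measurableType d) : Prop :=
  exists P : metricType R,
    [/\ forall F : set_system P, ProperFilter F -> cauchy F ->
          exists p : P, F --> p,
        exists2 D : set P, countable D & dense D &
        exists2 f : X -> P, bijective f &
          forall A : set X, measurable A <-> <<s (@open P) >> (f @` A)].

Definition atomless (R : realType) d (X : measurableType d)
    (mu : {measure set X -> \bar R}) : Prop :=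
  forall A, measurable A -> (0 < mu A)%E ->
    exists B, [/\ measurable B, B `<=` A & (0 < mu B < mu A)%E].

Section mpbij.
Context (R : realType) d (X : measurableType d) (mu : probability X R).

(** Measure-preserving Borel bijections, before identification a.e. *)
Record mpbij := MPBij {
  mp_fun :> X -> X ;
  mp_inv : X -> X ;
  mp_funK : cancel mp_fun mp_inv ;
  mp_invK : cancel mp_inv mp_fun ;
  mp_measurable : measurable_fun setT mp_fun ;
  mp_inv_measurable : measurable_fun setT mp_inv ;
  mp_preserving : forall A, measurable A -> mu (mp_fun @^-1` A) = mu A }.

HB.instance Definition _ := gen_eqMixin mpbij.
HB.instance Definition _ := gen_choiceMixin mpbij.

Lemma measurable_preimageT (f : X -> X) (A : set X) :
  measurable_fun setT f -> measurable A -> measurable (f @^-1` A).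
Proof. by move=> mf mA; rewrite -[_ @^-1` _]setTI; exact: mf. Qed.

Let mp_id_preserving A : measurable A -> mu (idfun @^-1` A) = mu A.
Proof. by []. Qed.

Definition mp_id : mpbij :=
  @MPBij idfun idfun (frefl _) (frefl _)
    (@measurable_id _ X setT) (@measurable_id _ X setT) mp_id_preserving.

Let mp_comp_preserving (f g : mpbij) A : measurable A ->
  mu ((f \o g) @^-1` A) = mu A.
Proof.
move=> mA; rewrite comp_preimage mp_preserving ?mp_preserving//.
by apply: measurable_preimageT => //; exact: mp_measurable.
Qed.

Definition mp_comp (f g : mpbij) : mpbij :=
  @MPBij (f \o g) (mp_inv g \o mp_inv f)
    (can_comp (@mp_funK f) (@mp_funK g)) (can_comp (@mp_invK g) (@mp_invK f))
    (measurableT_comp (@mp_measurable f) (@mp_measurable g))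
    (measurableT_comp (@mp_inv_measurable g) (@mp_inv_measurable f))
    (@mp_comp_preserving f g).

Let mp_sym_preserving (f : mpbij) A : measurable A ->
  mu (mp_inv f @^-1` A) = mu A.
Proof.
move=> mA; have mB : measurable (mp_inv f @^-1` A).
  by apply: measurable_preimageT => //; exact: mp_inv_measurable.
rewrite -(mp_preserving f mB); congr (mu _).
by apply/seteqP; split => x /=; rewrite mp_funK.
Qed.

Definition mp_sym (f : mpbij) : mpbij :=
  @MPBij (mp_inv f) f (@mp_invK f) (@mp_funK f)
    (@mp_inv_measurable f) (@mp_measurable f) (@mp_sym_preserving f).

Definition mp_aeeq (f g : mpbij) : bool := `[< {ae mu, forall x, f x = g x} >].

Let mp_aeeq_refl : reflexive mp_aeeq.
Proof. by move=> f; apply/asboolP; exact: aeW. Qed.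

Let mp_aeeq_sym : symmetric mp_aeeq.
Proof. by move=> f g; apply/asboolP/asboolP; apply: filterS => x ->. Qed.

Let mp_aeeq_trans : transitive mp_aeeq.
Proof.
move=> g f h /asboolP fg /asboolP gh; apply/asboolP.
by apply: filterS2 fg gh => x -> ->.
Qed.

Canonical mp_aeeq_equiv :=
  EquivRel mp_aeeq mp_aeeq_refl mp_aeeq_sym mp_aeeq_trans.

Lemma ae_mp_comp (P : X -> Prop) (g : mpbij) :
  {ae mu, forall x, P x} -> {ae mu, forall x, P (g x)}.
Proof.
move=> [N [mN N0 PN]]; exists (g @^-1` N); split.
- by apply: measurable_preimageT => //; exact: mp_measurable.
- by rewrite mp_preserving.
- by move=> x /= nP; exact: PN.
Qed.

Lemma mp_aeeq_comp (f f' g g' : mpbij) : mp_aeeq f f' -> mp_aeeq g g' ->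
  mp_aeeq (mp_comp f g) (mp_comp f' g').
Proof.
move=> /asboolP ff' /asboolP gg'; apply/asboolP.
by apply: filterS2 gg' (ae_mp_comp g ff') => x /= <- <-.
Qed.

Lemma mp_aeeq_inv (f f' : mpbij) : mp_aeeq f f' ->
  mp_aeeq (mp_sym f) (mp_sym f').
Proof.
move=> /asboolP ff'; apply/asboolP.
apply: filterS (ae_mp_comp (mp_sym f) ff') => x /= fx.
by apply: (can_inj (@mp_funK f')); rewrite -fx !mp_invK.
Qed.

Definition Aut : Type := {eq_quot mp_aeeq}%qT.
HB.instance Definition _ := Choice.on Aut.
HB.instance Definition _ := EqQuotient.on Aut.

Definition Aut_repr (U : Aut) : mpbij := repr U.
Coercion Aut_repr : Aut >-> mpbij.

Local Open Scope quotient_scope.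

Lemma Aut_piE (f g : mpbij) : \pi_Aut f = \pi_Aut g <-> mp_aeeq f g.
Proof. by split => [/eqmodP|?]; last exact/eqmodP. Qed.

Lemma Aut_reprK (f : mpbij) : mp_aeeq (\pi_Aut f : Aut) f.
Proof. by apply/Aut_piE; rewrite /Aut_repr reprK. Qed.

Definition Aut1 : Aut := \pi_Aut mp_id.
Definition AutM (U V : Aut) : Aut := \pi_Aut (mp_comp U V).
Definition AutV (U : Aut) : Aut := \pi_Aut (mp_sym U).

Let mp_eqW (f g : mpbij) : f =1 g -> mp_aeeq f g.
Proof. by move=> fg; apply/asboolP; exact: aeW. Qed.

Let AutMA : associative AutM.
Proof.
move=> U V W; apply/Aut_piE.
apply: (mp_aeeq_trans (y := mp_comp U (mp_comp V W))).
  by apply: mp_aeeq_comp; [exact: mp_aeeq_refl|exact: Aut_reprK].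
rewrite mp_aeeq_sym.
apply: (mp_aeeq_trans (y := mp_comp (mp_comp U V) W)).
  by apply: mp_aeeq_comp; [exact: Aut_reprK|exact: mp_aeeq_refl].
exact: mp_eqW.
Qed.

Let Aut_reprE (U : Aut) : U = \pi_Aut (U : mpbij).
Proof. by rewrite /Aut_repr reprK. Qed.

Let Aut1M : left_id Aut1 AutM.
Proof.
move=> U; rewrite [RHS]Aut_reprE; apply/Aut_piE.
apply: (mp_aeeq_trans (y := mp_comp mp_id U)); last exact: mp_eqW.
by apply: mp_aeeq_comp; [exact: Aut_reprK|exact: mp_aeeq_refl].
Qed.

Let AutM1 : right_id Aut1 AutM.
Proof.
move=> U; rewrite [RHS]Aut_reprE; apply/Aut_piE.
apply: (mp_aeeq_trans (y := mp_comp U mp_id)); last exact: mp_eqW.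
by apply: mp_aeeq_comp; [exact: mp_aeeq_refl|exact: Aut_reprK].
Qed.

Let AutVM : left_inverse Aut1 AutV AutM.
Proof.
move=> U; apply/Aut_piE; apply: (mp_aeeq_trans (y := mp_comp (mp_sym U) U)).
  by apply: mp_aeeq_comp; [exact: Aut_reprK|exact: mp_aeeq_refl].
by apply: mp_eqW => x /=; rewrite mp_funK.
Qed.

Let AutMV : right_inverse Aut1 AutV AutM.
Proof.
move=> U; apply/Aut_piE; apply: (mp_aeeq_trans (y := mp_comp U (mp_sym U))).
  by apply: mp_aeeq_comp; [exact: mp_aeeq_refl|exact: Aut_reprK].
by apply: mp_eqW => x /=; rewrite mp_invK.
Qed.

HB.instance Definition _ := isGroup.Build Aut AutMA Aut1M AutM1 AutVM AutMV.

End mpbij.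

(** Subgroup generated by a subset of a (possibly infinite) group. *)
Definition generated_subgroup (G : groupType) (S : set G) : set G :=
  \bigcap_(H in [set H : set G |
      group_closed [pred x : G | x \in H] /\ S `<=` H]) H.

Section full_groups.
Context (R : realType) d (X : measurableType d) (mu : probability X R).
Implicit Types (T U : Aut mu) (A : set X) (x : X).

(** [mp_pow f n x] is f^n(x), for n in Z. *)
Definition mp_pow (f : mpbij mu) (n : int) x : X :=
  match n with
  | Posz k => iter k f x
  | Negz k => iter k.+1 (mp_inv f) x
  end.

Definition orbitz (f : mpbij mu) x : set X := range (fun n : int => mp_pow f n x).

Definition ergodic T : Prop :=
  forall A, measurable A -> (forall x, A x -> orbitz T x `<=` A) ->
    mu A = 0%E \/ mu A = 1%E.

Definition full_group T : set (Aut mu) :=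
  [set U | {ae mu, forall x, orbitz T x (U x)}].

(** For ergodic [T] on an atomless space, a.e. orbit is infinite, so that
    a cocycle is unique up to a null set. *)
Definition cocycle T U (c : X -> int) : Prop :=
  measurable_fun setT (fun x => (c x)%:~R : R) /\
  {ae mu, forall x, U x = mp_pow T (c x) x}.

Definition L1_full_group T : set (Aut mu) :=
  [set U | full_group T U /\
     exists2 c, cocycle T U c & (\int[mu]_x (`|c x|%:~R)%:E < +oo)%E].

Definition periodic U : Prop := {ae mu, forall x, finite_set (orbitz U x)}.

Definition first_return (f : mpbij mu) A x (n : nat) : Prop :=
  [/\ (0 < n)%N, A (iter n f x) &
      forall m, (0 < m < n)%N -> ~ A (iter m f x)].

(** [U] is T_A. The return time is required to exist only for a.e. point of
    [A], where it does by Poincare recurrence. *)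
Definition is_induced T A U : Prop :=
  {ae mu, forall x,
     (A x -> exists2 n, first_return T A x n & U x = iter n T x) /\
     (~ A x -> U x = x)}.

Definition Per_L1 T : set (Aut mu) := L1_full_group T `&` periodic.

Definition Ind_L1 T : set (Aut mu) :=
  [set U | exists A, [/\ measurable A, (0 < mu A)%E & is_induced T A U]].

End full_groups.

(* Main.v *)
Require Import Defs.
From HB Require Import structures.
From mathcomp Require Import all_boot all_order all_algebra.
From mathcomp Require Import all_classical all_reals all_analysis.
From mathcomp Require Import measurable_realfun zify.
Local Open Scope classical_set_scope.
Local Open Scope ring_scope.

(** [[T]_1] is a group because cocycles add up along compositions
    ([L1_full_groupB]), and it contains the induced transformations because
    the return time to A is integrable by Kac's tower argument ([Ind_L1_sub]).
    The converse inclusion rests on the claim that each U in [[T]_1] is a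
    product T^i W V with V an involution and W periodic, both in [[T]_1]
    ([periodic_decomposition]); T itself is the transformation induced on X.

    By ergodicity either almost every T-orbit is finite, and then U is already
    periodic, or almost every T-orbit is a copy of Z ([finite_orbit_or_free]).
    In the second case U acts on the orbit of x as the permutation
    s(n) = n + c(T^n x) of Z. Since c is integrable, the Borel-Cantelli lemma
    gives |c(T^n x)| < |n| for all but finitely many n
    ([ae_finite_crossings]): only finitely many integers cross the cut
    between -1 and 0, in either direction. Replacing s by s - i for a suitable
    i, as many cross to the right as to the left, and a finite involution of Z
    which pairs the former with the latter, followed by s - i, maps the
    negative integers onto themselves ([balanced_cut]).

    The integer i and the pairing range over a countable set, so they are
    constant on a set of positive measure ([pos_exists]), which contains a set
    A of positive measure whose points are so far apart along their orbits
    that the pairings at different points of A do not overlap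
    ([pos_separated]). Performing the pairing at every point of A is an
    involution V with bounded cocycle, and W = T^-i U V preserves both half
    orbits at every point of A ([cut_swap_balanced]). Almost every orbit visits
    A infinitely often in the past and in the future
    ([ae_two_sided_visits]), hence is divided into finite intervals that W
    preserves, and W is periodic ([finite_orbit_between_cuts]). *)

Set Implicit Arguments.
Unset Strict Implicit.
Unset Printing Implicit Defensive.
Import Order.TTheory GRing.Theory Num.Theory.

(** * Balancing the crossings of a cut of Z *)

Section swap.
Implicit Types (p : seq int * seq int) (k : int).

(** The involution exchanging the j-th entries of two lists; such a pair of
    lists encodes a finitely supported involution of Z by an element of a
    countable type. *)
Definition swap p k : int :=
  if k \in p.1 then nth 0 p.2 (index k p.1)
  else if k \in p.2 then nth 0 p.1 (index k p.2) else k.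

Definition pairing p : bool := uniq (p.1 ++ p.2) && (size p.1 == size p.2).

Lemma swap1_in p k : pairing p -> k \in p.1 -> swap p k \in p.2.
Proof.
move=> /andP[_ /eqP sp] kp; rewrite /swap kp mem_nth// -sp index_mem//.
Qed.

Lemma swap2_in p k : pairing p -> k \in p.2 -> swap p k \in p.1.
Proof.
move=> /andP[]; rewrite cat_uniq => /and3P[_ /hasPn h _] /eqP sp kp.
by rewrite /swap kp (negbTE (h _ kp)) mem_nth// sp index_mem.
Qed.

Lemma swap_out p k : k \notin p.1 ++ p.2 -> swap p k = k.
Proof. by rewrite mem_cat negb_or /swap => /andP[/negbTE-> /negbTE->]. Qed.

Lemma swap_mem p k : pairing p -> (swap p k \in p.1 ++ p.2) = (k \in p.1 ++ p.2).
Proof.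
move=> pp; case: (boolP (k \in p.1 ++ p.2)) => [|kp].
  by rewrite !mem_cat => /orP[/(swap1_in pp)->|/(swap2_in pp)->]; rewrite ?orbT.
by rewrite swap_out//; exact/negbTE.
Qed.

Lemma swapK p : pairing p -> involutive (swap p).
Proof.
move=> pp k; have := pp => /andP[].
rewrite cat_uniq => /and3P[u1 /hasPn h u2] /eqP sp.
have [k1|k1] := boolP (k \in p.1).
  have k2 := swap1_in pp k1; rewrite {1}/swap (negbTE (h _ k2)) k2.
  by rewrite /swap k1 index_uniq ?nth_index// -sp index_mem.
have [k2|k2] := boolP (k \in p.2); last by rewrite !swap_out// mem_cat negb_or k1.
have k3 := swap2_in pp k2; rewrite {1}/swap k3.
by rewrite /swap (negbTE k1) k2 index_uniq ?nth_index// sp index_mem.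
Qed.

End swap.

Section cut.
Implicit Types (k i j : int) (n b : nat).

(** Half-open, so that the cut between -1 and 0 halves it. *)
Definition window n : seq int := [seq m%:Z - n%:Z | m <- iota 0 n.*2].

Lemma mem_window n k : (k \in window n) = (- n%:Z <= k < n%:Z).
Proof.
apply/mapP/idP => [[m]|kn]; first by rewrite mem_iota => ? ->; lia.
by exists (absz (k + n%:Z)); [rewrite mem_iota|]; lia.
Qed.

Lemma window_uniq n : uniq (window n).
Proof. by rewrite map_inj_uniq ?iota_uniq// => a b; lia. Qed.

Lemma windowS n : perm_eq (window n.+1) [:: - n.+1%:Z, n%:Z & window n].
Proof.
apply: uniq_perm; first exact: window_uniq.
  rewrite /= window_uniq !inE !mem_window; lia.
by move=> k; rewrite mem_window !inE mem_window; lia.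
Qed.

Definition below (s : int -> int) n i := count (fun k => s k < i) (window n).

(** Enlarging the window by one on both sides adds one preimage of a negative
    integer, namely the new left end. *)
Lemma below0 (s : int -> int) b n :
  (forall k, k \notin window b -> (s k < 0) = (k < 0)) -> (b <= n)%N ->
  below s n 0 = (below s b 0 + (n - b))%N.
Proof.
move=> sb; elim: n => [|n IH]; first by rewrite leqn0 => /eqP->; rewrite addn0.
rewrite leq_eqVlt => /orP[/eqP->|bn]; first by rewrite subnn addn0.
rewrite /below (permP (windowS n)) /= -/(below s n 0) IH// !sb ?mem_window; rewrite -?/(below s b 0); lia.
Qed.

Lemma belowS (s t : int -> int) n i : cancel s t -> cancel t s ->
  t i \in window n -> below s n (i + 1) = (below s n i).+1.
Proof.
move=> st ts ti; rewrite -addn1.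
have <- : count_mem (t i) (window n) = 1%N by rewrite count_uniq_mem ?window_uniq// ti.
rewrite -count_predUI [X in (_ + X)%N](_ : _ = 0%N) ?addn0; last first.
  apply/eqP; rewrite -[_ == _]negbK -lt0n -has_count -all_predC.
  by apply/allP => k _ /=; apply/negP => /andP[+ /eqP e]; rewrite e ts ltxx.
apply: eq_count => k /=; rewrite -(inj_eq (can_inj st)) ts.
by rewrite ltzD1 le_eqVlt orbC.
Qed.

(** Raising the level by one adds exactly one point, the preimage of the level,
    once the window contains that preimage. *)
Lemma below_shift (s t : int -> int) n b i : cancel s t -> cancel t s ->
  (forall j, (absz j <= b)%N -> t j \in window n) -> (absz i <= b)%N ->
  (below s n i)%:Z = (below s n 0)%:Z + i.
Proof.
move=> st ts tw.
elim/int_ind: i => [|m IH|m IH] mb; first by rewrite addr0.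
- have {}IH := IH ltac:(lia).
  have -> : m.+1%:Z = m%:Z + 1 by lia.
  rewrite (belowS st ts); [lia|apply: tw; lia].
- have {}IH := IH ltac:(lia).
  have twm : t (- m.+1%:Z) \in window n by apply: tw; lia.
  have := belowS st ts twm.
  have -> : - m.+1%:Z + 1 = - m%:Z :> int by lia.
  lia.
Qed.

Lemma seq_window (l : seq int) : exists n, {subset l <= window n}.
Proof.
elim: l => [|k l [n ln]]; first by exists 0%N.
exists (maxn n (absz k).+1) => j; rewrite inE => /orP[/eqP->|/ln];
  rewrite !mem_window; lia.
Qed.

(** In a large window the number of k with s k < 0 differs from the number of
    negative k by a constant, the flow of s through the cut. Taking it as i
    makes {k < 0, i <= s k} and {0 <= k, s k < i} equinumerous; pairing them
    in any way corrects all crossings. *)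
Lemma balanced_cut (s : int -> int) b : bijective s ->
  (forall k, k \notin window b -> (s k < 0) = (k < 0)) ->
  exists i p, pairing p /\ forall k, (s (swap p k) < i) = (k < 0).
Proof.
move=> [t st ts] sb; pose i := b%:Z - (below s b 0)%:Z.
have [m0 m0P] := seq_window [seq t j | j <- window (absz i).+1].
(* The window must also contain the preimages of all levels between 0 and i:
   outside of it the conditions s k < 0 and s k < i then agree. *)
pose n := maxn m0 b.
have tw j : (absz j <= absz i)%N -> t j \in window n.
  move=> ji; have : t j \in window m0 by apply/m0P/map_f; rewrite mem_window; lia.
  rewrite !mem_window; lia.
have bi : below s n i = n.
  apply/eqP; rewrite -eqz_nat (below_shift st ts tw)// (below0 sb) /n; lia.
have si k : k \notin window n -> (s k < i) = (k < 0).
  move=> kn; have kb : k \notin window b by move: kn; rewrite !mem_window /n; lia.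
  have : ~~ (absz (s k) <= absz i)%N by apply: contra kn => /tw; rewrite st.
  have := sb k kb; lia.
have neg : count (fun k => k < 0) (window n) = n.
  by have := @below0 id 0%N n (fun _ _ => erefl) (leq0n n); rewrite subn0.
pose l := [seq k <- window n | (k < 0) && ~~ (s k < i)].
pose r := [seq k <- window n | ~~ (k < 0) && (s k < i)].
have pp : pairing (l, r).
  rewrite /pairing cat_uniq !filter_uniq ?window_uniq//= andbT; apply/andP; split.
    by apply/hasPn => k; rewrite !mem_filter => /andP[/andP[/negbTE-> _] _].
  have split_count (P Q : pred int) : count P (window n) =
      (count (predI P (predC Q)) (window n) + count (predI P Q) (window n))%N.
    by elim: (window n) => //= k w ->; case: (P k); case: (Q k) => /=; lia.
  have := split_count (fun k => k < 0) (fun k => s k < i).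
  have := split_count (fun k => s k < i) (fun k => k < 0).
  rewrite neg -[count (fun k => s k < i) _]/(below s n i) bi !size_filter.
  have -> : count (predI (fun k => s k < i) (fun k => k < 0)) (window n) =
            count (predI (fun k => k < 0) (fun k => s k < i)) (window n).
    by apply: eq_count => k /=; rewrite andbC.
  have -> : count (predI (fun k => s k < i) (predC (fun k => k < 0))) (window n) =
            count (fun k => ~~ (k < 0) && (s k < i)) (window n).
    by apply: eq_count => k /=; rewrite andbC.
  rewrite -[count (predI (fun k => k < 0) (predC _)) _]/(count (fun k => (k < 0) && ~~ (s k < i)) _).
  move=> e1 e2; apply/eqP/(@addIn (count (predI (fun k => k < 0) (fun k => s k < i)) (window n))).
  by rewrite -e1 -e2.
exists i, (l, r); split=> // k.
have [kl|kl] := boolP (k \in l).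
  have := swap1_in pp kl; rewrite mem_filter => /andP[/andP[_ ->] _].
  by move: kl; rewrite mem_filter => /andP[/andP[-> _] _].
have [kr|kr] := boolP (k \in r).
  have := swap2_in pp kr; rewrite mem_filter => /andP[/andP[_ /negbTE->] _].
  by move: kr; rewrite mem_filter => /andP[/andP[/negbTE-> _] _].
rewrite swap_out ?mem_cat ?negb_or ?kl//.
have [kn|/si//] := boolP (k \in window n).
by move: kl kr; rewrite !mem_filter kn !andbT; case: (k < 0); case: (s k < i).
Qed.

End cut.

(** * Integer-valued measurable functions and powers of a transformation *)

Section countable_measurability.
Context d (X : measurableType d).

Lemma measurable_exists (I : countType) (F : I -> set X) :
  (forall i, measurable (F i)) -> measurable [set x | exists i, F i x].
Proof.
move=> mF; rewrite (_ : [set x | _] = \bigcup_i F i); last first.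
  by apply/seteqP; split => x [i]; exists i.
exact: countable_bigcupT_measurable.
Qed.

Lemma measurable_forall (I : countType) (F : I -> set X) :
  (forall i, measurable (F i)) -> measurable [set x | forall i, F i x].
Proof.
move=> mF; rewrite (_ : [set x | _] = ~` [set x | exists i, (~` F i) x]).
  by apply: measurableC; apply: measurable_exists => i; exact: measurableC.
apply/seteqP; split => x /=; first by move=> Fx [i]; apply; exact: Fx.
by move=> h i; apply: contrapT => nF; apply: h; exists i.
Qed.

Lemma measurable_Prop (P : Prop) : measurable [set _ : X | P].
Proof.
case: (pselect P) => p.
  by rewrite (_ : mkset _ = setT)//; apply/seteqP; split.
by rewrite (_ : mkset _ = set0)//; apply/seteqP; split.
Qed.

Definition int_measurable (c : X -> int) : Prop :=
  forall n, measurable [set x | c x = n].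

Lemma int_measurable_pred (c : X -> int) (P : int -> Prop) :
  int_measurable c -> measurable [set x | P (c x)].
Proof.
move=> mc; rewrite (_ : mkset _ = [set x | exists n, ([set x | c x = n] `&` [set _ | P n]) x]).
  by apply: measurable_exists => n; apply: measurableI => //; exact: measurable_Prop.
by apply/seteqP; split => x /=; [exists (c x)|case=> n [->]].
Qed.

Lemma int_measurable_cst n : int_measurable (fun=> n).
Proof. by move=> m; exact: measurable_Prop. Qed.

Lemma int_measurable_comp (c : X -> int) (f : X -> X) :
  int_measurable c -> measurable_fun setT f -> int_measurable (c \o f).
Proof. by move=> mc mf n; exact: measurable_preimageT (mc n). Qed.

(** This gives the measurability of every map of the form x |-> T^(c x) x. *)
Lemma measurable_glue (c : X -> int) (F : int -> set X) : int_measurable c ->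
  (forall n, measurable (F n)) -> measurable [set x | F (c x) x].
Proof.
move=> mc mF; rewrite (_ : mkset _ = [set x | exists n, ([set x | c x = n] `&` F n) x]).
  by apply: measurable_exists => n; exact: measurableI.
by apply/seteqP; split => x /=; [exists (c x)|case=> n [->]].
Qed.

Lemma int_measurable_op2 (c1 c2 : X -> int) (op : int -> int -> int) :
  int_measurable c1 -> int_measurable c2 -> int_measurable (fun x => op (c1 x) (c2 x)).
Proof.
move=> m1 m2 n; apply: (measurable_glue (F := fun m => [set x | op m (c2 x) = n])) => // m.
exact: (int_measurable_pred (fun k => op m k = n) m2).
Qed.

Lemma int_measurableP (R : realType) (c : X -> int) :
  measurable_fun setT (fun x => (c x)%:~R : R) <-> int_measurable c.
Proof.
split=> [mc n|mc].
  have := mc measurableT _ (measurable_set1 (n%:~R : R)); rewrite setTI.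
  by congr measurable; apply/seteqP; split => x /=; [move/intr_inj|move->].
move=> _ B mB; rewrite setTI.
exact: (int_measurable_pred (fun n => B n%:~R)).
Qed.

End countable_measurability.

Section ae.
Context (R : realType) d (X : measurableType d) (mu : probability X R).

Lemma ae_forall_countable (I : countType) (P : I -> X -> Prop) :
  (forall i, {ae mu, forall x, P i x}) -> {ae mu, forall x, forall i, P i x}.
Proof.
move=> aeP; have : {ae mu, forall x, forall n : nat, if unpickle n is Some i then P i x else True}.
  by apply: ae_foralln => n; case: unpickle => [i//|]; exact: aeW.
by apply: filterS => x Px i; have := Px (pickle i); rewrite pickleK.
Qed.

Lemma ae_not_null A : measurable A -> {ae mu, forall x, ~ A x} -> mu A = 0%E.
Proof.
move=> mA; rewrite /almost_everywhere/= => -[N [mN N0 AN]].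
by apply: (subset_measure0 mA mN) => // x Ax; apply: AN => /=; apply.
Qed.

Lemma null_ae_not A : measurable A -> mu A = 0%E -> {ae mu, forall x, ~ A x}.
Proof. by move=> mA A0; exists A; split => // x /= /contrapT. Qed.

Lemma full_ae A : measurable A -> mu A = 1%E -> {ae mu, forall x, A x}.
Proof.
move=> mA A1; exists (~` A); split => //; first exact: measurableC.
by rewrite probability_setC// A1 subee.
Qed.

(** Countably many null sets do not cover a set of positive measure. This
    turns data depending on the point into constant data. *)
Lemma pos_exists (I : countType) A (F : I -> set X) :
  measurable A -> (forall i, measurable (F i)) -> (0 < mu A)%E ->
  {ae mu, forall x, A x -> exists i, F i x} -> exists i, (0 < mu (A `&` F i))%E.
Proof.
move=> mA mF A0 AF; apply: contrapT => noi.
suff : mu A = 0%E by move=> h; rewrite h ltxx in A0.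
apply: ae_not_null => //.
have : {ae mu, forall x i, ~ (A `&` F i) x}.
  apply: ae_forall_countable => i; apply: null_ae_not; first exact: measurableI.
  by apply: contrapT => /eqP nz; apply: noi; exists i; rewrite lt0e nz/=.
by apply: filterS2 AF => x AFx h Ax; have [i Fi] := AFx Ax; exact: (h i).
Qed.

End ae.

Section powers.
Context (R : realType) d (X : measurableType d) (mu : probability X R).
Implicit Types (f : mpbij mu) (n m : int) (x : X).

Lemma mp_powS f n x : mp_pow f (n + 1) x = f (mp_pow f n x).
Proof.
case: n => [n|[|n]]; first by rewrite -[Posz n + 1]/(Posz (n + 1)) addn1.
  by rewrite /= mp_invK.
rewrite (_ : Negz n.+1 + 1 = Negz n); last by lia.
by rewrite [RHS]/= mp_invK.
Qed.

Lemma mp_powD f m n x : mp_pow f (m + n) x = mp_pow f m (mp_pow f n x).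
Proof.
elim/int_ind: m => [|m IH|m IH]; first by rewrite add0r.
- have -> : m.+1%:Z = m%:Z + 1 by lia.
  by rewrite mp_powS -IH -mp_powS; congr mp_pow; lia.
- apply: (can_inj (@mp_funK _ _ _ _ f)); rewrite -!mp_powS.
  rewrite (_ : - m.+1%:Z + 1 = - m%:Z); last by lia.
  by rewrite -IH; congr mp_pow; lia.
Qed.

Lemma mp_powN f n : cancel (mp_pow f n) (mp_pow f (- n)).
Proof. by move=> x; rewrite -mp_powD addNr. Qed.

Lemma mp_powNK f n : cancel (mp_pow f (- n)) (mp_pow f n).
Proof. by move=> x; rewrite -mp_powD addrN. Qed.

Lemma measurable_mp_pow f n : measurable_fun setT (mp_pow f n).
Proof.
elim/int_ind: n => [|m IH|m IH]; first exact: measurable_id.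
- rewrite (_ : mp_pow f _ = f \o mp_pow f m) //.
  by apply: measurableT_comp => //; exact: mp_measurable.
- rewrite (_ : mp_pow f _ = mp_inv f \o mp_pow f (- m%:Z)); last first.
    apply/funext => x; apply: (can_inj (@mp_funK _ _ _ _ f)).
    by rewrite [in RHS]/comp mp_invK -mp_powS; congr mp_pow; lia.
  by apply: measurableT_comp => //; exact: mp_inv_measurable.
Qed.

Lemma measurable_mp_pow_preimage f n (A : set X) :
  measurable A -> measurable (mp_pow f n @^-1` A).
Proof. exact/measurable_preimageT/measurable_mp_pow. Qed.

Lemma mp_pow_preserving f n (A : set X) :
  measurable A -> mu (mp_pow f n @^-1` A) = mu A.
Proof.
move=> mA; elim/int_ind: n => [|m IH|m IH] //.
- rewrite (_ : mp_pow f _ = mp_pow f m \o f); last first.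
    by apply/funext => x /=; rewrite -iterSr.
  by rewrite comp_preimage mp_preserving//; exact: measurable_mp_pow_preimage.
- rewrite -IH (_ : mp_pow f (- m%:Z) = mp_pow f (- m.+1%:Z) \o f); last first.
    apply/funext => x; rewrite [in RHS]/comp -[f x]/(mp_pow f 1 x) -mp_powD.
    by congr mp_pow; lia.
  by rewrite comp_preimage mp_preserving//; exact: measurable_mp_pow_preimage.
Qed.

Definition mp_powb f n : mpbij mu :=
  MPBij (mp_powN f n) (mp_powNK f n) (measurable_mp_pow f n)
    (measurable_mp_pow f (- n)) (@mp_pow_preserving f n).

Lemma ae_mp_pow f (P : X -> Prop) :
  {ae mu, forall x, P x} -> {ae mu, forall x n, P (mp_pow f n x)}.
Proof.
by move=> aeP; apply: ae_forall_countable => n; exact: (@ae_mp_comp _ _ _ _ P (mp_powb f n) aeP).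
Qed.

Lemma orbitz_pow f n x : orbitz f x (mp_pow f n x).
Proof. by exists n. Qed.

Lemma orbitz_sym f x y : orbitz f x y -> orbitz f y x.
Proof. by move=> [n _ <-]; exists (- n); rewrite ?mp_powN. Qed.

Lemma orbitz_trans f x y z : orbitz f x y -> orbitz f y z -> orbitz f x z.
Proof. by move=> [n _ <-] [m _ <-]; exists (m + n); rewrite ?mp_powD. Qed.

End powers.

(** * Integrable cocycles form a group *)

Section integrable_cocycles.
Context (R : realType) d (X : measurableType d) (mu : probability X R).
Implicit Types (c : X -> int).

Definition int_integrable c : Prop := (\int[mu]_x (`|c x|%:~R)%:E < +oo)%E.

Lemma nat_eseries (n : nat) :
  (\sum_(0 <= k <oo) ((k < n)%N%:R : R)%:E = (n%:R)%:E)%E.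
Proof.
rewrite (nneseries_split 0 n) => [|k _]; last by rewrite lee_fin.
rewrite add0n eseries0 ?adde0 => [|k nk _]; last by rewrite ltnNge nk.
rewrite (eq_big_nat _ _ (F2 := fun=> 1%:E)) => [|k /= kn]; last by rewrite kn.
by rewrite sumEFin sumr_const_nat subn0.
Qed.

Lemma measurable_norm_int c : int_measurable c ->
  measurable_fun setT (fun x => (`|c x|%:~R)%:E : \bar R).
Proof.
move=> mc; apply/measurable_EFinP/int_measurableP => n.
exact: (int_measurable_pred (fun k => `|k| = n)).
Qed.

(** Layer-cake formula: |c x| counts the k with k < |c x|. It makes the
    integral accessible to Borel-Cantelli and to disjointness arguments. *)
Lemma integral_tail c : int_measurable c ->
  (\int[mu]_x (`|c x|%:~R)%:E =
   \sum_(0 <= k <oo) mu [set x | (k%:Z < `|c x|)%R])%E.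
Proof.
move=> mc.
have mE k : measurable [set x | k%:Z < `|c x|].
  exact: (int_measurable_pred (fun n => k%:Z < `|n|)).
transitivity (\int[mu]_x \sum_(0 <= k <oo) (\1_[set x | (k%:Z < `|c x|)%R] x)%:E)%E.
  apply: eq_integral => x _; rewrite -[`|c x|]abszE -pmulrn -nat_eseries.
  by apply: eq_eseriesr => k _; rewrite indicE mem_setE.
rewrite integral_nneseries//.
  by apply: eq_eseriesr => k _; rewrite integral_indic// setIT.
- by move=> k; apply/measurable_EFinP; exact: measurable_indic.
Qed.

Lemma int_integrableD c1 c2 : int_measurable c1 -> int_measurable c2 ->
  int_integrable c1 -> int_integrable c2 ->
  int_integrable (fun x => c1 x + c2 x).
Proof.
move=> m1 m2 i1 i2; rewrite /int_integrable.
apply: (@le_lt_trans _ _ (\int[mu]_x ((`|c1 x|%:~R)%:E + (`|c2 x|%:~R)%:E)))%E.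
  apply: ge0_le_integral => //.
  - exact/measurable_norm_int/int_measurable_op2.
  - by apply: emeasurable_funD; exact: measurable_norm_int.
  - by move=> x _; rewrite -EFinD lee_fin -intrD ler_int ler_normD.
rewrite ge0_integralD//; first by rewrite lte_add_pinfty.
all: try by move=> x _; rewrite lee_fin ler0z.
all: exact: measurable_norm_int.
Qed.

(** All tails of the distribution of |c| are invariant under g. *)
Lemma int_integrable_comp c (g : mpbij mu) : int_measurable c ->
  int_integrable c -> int_integrable (c \o g).
Proof.
move=> mc; rewrite /int_integrable !integral_tail//; last first.
  exact/int_measurable_comp/mp_measurable.
congr (_ < _)%E; apply: eq_eseriesr => k _.
rewrite -(mp_preserving g)//.
exact: (int_measurable_pred (fun n => k%:Z < `|n|)).
Qed.

Lemma int_integrable_bounded c (M : int) : int_measurable c ->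
  (forall x, `|c x| <= M) -> int_integrable c.
Proof.
move=> mc cM; rewrite /int_integrable.
apply: (@le_lt_trans _ _ (\int[mu]_x (M%:~R)%:E))%E; last first.
  by rewrite integral_cst// [X in (_ * X)%E]probability_setT mule1 ltry.
apply: ge0_le_integral => //.
- exact: measurable_norm_int.
- by move=> x _; rewrite lee_fin ler_int.
Qed.

End integrable_cocycles.

Section L1_group.
Context (R : realType) d (X : measurableType d) (mu : probability X R).
Implicit Types (T U V : Aut mu).

Lemma Aut_repr_pi (f : mpbij mu) :
  {ae mu, forall x, (\pi_(Aut mu)%qT f : Aut mu) x = f x}.
Proof. exact/asboolP/Aut_reprK. Qed.

Lemma AutM_ae U V : {ae mu, forall x, ((U * V)%g : Aut mu) x = U (V x)}.
Proof. exact: (Aut_repr_pi (mp_comp U V)). Qed.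

Lemma AutV_ae U : {ae mu, forall x, ((U^-1)%g : Aut mu) x = mp_inv U x}.
Proof. exact: (Aut_repr_pi (mp_sym U)). Qed.

Lemma L1_full_groupP T U : L1_full_group T U <->
  exists c, [/\ int_measurable c, {ae mu, forall x, U x = mp_pow T (c x) x} &
                int_integrable mu c].
Proof.
split=> [[_ [c [/int_measurableP mc Uc] ic]]|[c [mc Uc ic]]]; first by exists c.
split; first by apply: filterS Uc => x ->; exact: orbitz_pow.
by exists c => //; split => //; exact/int_measurableP.
Qed.

Lemma L1_full_group1 T : L1_full_group T (1%g : Aut mu).
Proof.
apply/L1_full_groupP; exists (fun=> 0); split.
- exact: int_measurable_cst.
- exact: (Aut_repr_pi (mp_id mu)).
- apply: (@int_integrable_bounded _ _ _ _ _ 0) => [|x]; last by rewrite normr0.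
  exact: int_measurable_cst.
Qed.

Lemma L1_full_groupB T U V :
  L1_full_group T U -> L1_full_group T V -> L1_full_group T (U * V^-1)%g.
Proof.
move=> /L1_full_groupP[c [mc Uc ic]] /L1_full_groupP[e [me Ve ie]].
(* V^-1 undoes at x the jump that V makes at V^-1 x. *)
pose e' x := - e (mp_inv V x).
have me' : int_measurable e'.
  apply: (@int_measurable_comp _ _ (fun x => - e x)); last exact: mp_inv_measurable.
  by move=> n; exact: (int_measurable_pred (fun k => - k = n)).
have ie' : int_integrable mu e'.
  have := int_integrable_comp (mp_sym V) me ie.
  by congr (_ < _)%E; apply: eq_integral => x _; rewrite /e' normrN.
have Ve' : {ae mu, forall x, mp_inv V x = mp_pow T (e' x) x}.
  apply: filterS (ae_mp_comp (mp_sym V) Ve) => x /=; rewrite mp_invK => xE.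
  by rewrite -[LHS](mp_powN T (e (mp_inv V x))) -xE.
apply/L1_full_groupP; exists (fun x => c (mp_inv V x) + e' x); split.
- apply: int_measurable_op2 => //; apply: int_measurable_comp => //.
  exact: mp_inv_measurable.
- have UVV' := ae_mp_comp (mp_sym V) Uc.
  have {UVV'}UV' : {ae mu, forall x, U (mp_inv V x) = mp_pow T (c (mp_inv V x) + e' x) x}.
    by apply: filterS2 UVV' Ve' => x /= -> e'x; rewrite mp_powD -e'x.
  apply: filterS2 (AutM_ae U V^-1%g) (filterI (AutV_ae V) UV') => x -> [-> ->] //.
- apply: (int_integrableD (c1 := c \o mp_inv V)) => //; last exact: (int_integrable_comp (mp_sym V)).
  by apply: int_measurable_comp => //; exact: mp_inv_measurable.
Qed.

Lemma L1_full_group_closed T :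
  group_closed [pred U : Aut mu | U \in L1_full_group T].
Proof.
split=> [|U V]; rewrite !inE; first exact: L1_full_group1.
exact: L1_full_groupB.
Qed.

End L1_group.

(** * Recurrence *)

Section recurrence.
Context (R : realType) d (X : measurableType d) (mu : probability X R).
Variable T : mpbij mu.

(** The floors T^k (E k) of the tower are disjoint, and T preserves mu. *)
Lemma tower_sum (E : nat -> set X) : (forall k, measurable (E k)) ->
  (forall k l x y, (k < l)%N -> E k x -> E l y -> mp_pow T k x <> mp_pow T l y) ->
  (\sum_(0 <= k <oo) mu (E k) <= 1)%E.
Proof.
move=> mE dE; pose F k := mp_pow T (- k%:Z) @^-1` E k.
have mF k : measurable (F k) by exact: measurable_mp_pow_preimage.
rewrite (eq_eseriesr (g := fun k => mu (F k))) => [|k _]; last by rewrite mp_pow_preserving.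
have tF : trivIset setT F.
  have ltF k l : (k < l)%N -> ~ (F k `&` F l !=set0).
    by move=> kl [x [Fk Fl]]; apply: (dE k l _ _ kl Fk Fl); rewrite !mp_powNK.
  move=> k l _ _ kl0; case: (ltngtP k l) => // kl; exfalso.
    exact: (ltF _ _ kl).
  by apply: (ltF _ _ kl); rewrite setIC.
have := measure_bigcup mu setT F (fun k _ => mF k) tF.
rewrite (eq_eseriesl (Q := xpredT)) => [<-|k]; last by rewrite in_setT.
by apply: probability_le1; apply: bigcup_measurable.
Qed.

(** The points of A after which A is never visited again form a wandering
    set: its images under T are disjoint and have the same measure. *)
Lemma null_last_visit A : measurable A ->
  mu (A `&` [set x | forall n : nat, ~ A (mp_pow T n.+1 x)]) = 0%E.
Proof.
move=> mA; set W := A `&` _.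
have mW : measurable W.
  apply: measurableI => //; apply: measurable_forall => n; apply: measurableC.
  exact: measurable_mp_pow_preimage.
have <- : lim_sup_set (fun=> W) = W.
  by apply/seteqP; split => [x /(_ 0%N I) [] //|x Wx n _]; exists n => /=.
apply: lim_sup_set_cvg0 => //; apply: le_lt_trans (ltry 1).
apply: tower_sum => // k l x y kl [Ax _] [_ Wy] e.
apply: (Wy (l - k).-1); rewrite prednK ?subn_gt0//.
suff -> : mp_pow T (l - k)%N y = x by [].
by apply: (can_inj (mp_powN T k)); rewrite e -mp_powD; congr mp_pow; lia.
Qed.

End recurrence.

(** * Induced transformations *)

Section induced.
Context (R : realType) d (X : measurableType d) (mu : probability X R).
Implicit Types (T U : Aut mu) (A : set X).

Lemma first_return_inj (f : mpbij mu) A x n m :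
  first_return f A x n -> first_return f A x m -> n = m.
Proof.
move=> [n0 An nA] [m0 Am mA]; case: (ltngtP n m) => // h.
- by case: (mA n) => //; rewrite n0.
- by case: (nA m) => //; rewrite m0.
Qed.

Lemma Ind_L1_sub T : Ind_L1 T `<=` L1_full_group T.
Proof.
move=> U [A [mA _ UA]].
pose G n : set X := A `&` [set x | first_return T A x n].
have mG n : measurable (G n).
  apply: measurableI => //.
  rewrite (_ : [set x | _] = [set _ : X | (0 < n)%N] `&` (mp_pow T n @^-1` A) `&`
     [set x | forall m : nat, ([set _ : X | ~ (0 < m < n)%N] `|` ~` (mp_pow T m @^-1` A)) x]).
    apply: measurableI.
      by apply: measurableI; [exact: measurable_Prop|exact: measurable_mp_pow_preimage].
    apply: measurable_forall => m; apply: measurableU; first exact: measurable_Prop.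
    by apply: measurableC; exact: measurable_mp_pow_preimage.
  apply/seteqP; split => x /=.
    move=> [n0 An nA]; split => // m.
    by case: (pselect (0 < m < n)%N) => [/nA|]; [right|left].
  by move=> [[n0 An] nA]; split => // m mn; case: (nA m).
pose r x : nat := xget 0%N [set n | G n x].
have rG n x : G n x -> r x = n.
  move=> Gn; have /= [_ h] := @xgetPex _ 0%N [set n | G n x] (ex_intro _ n Gn).
  exact: (first_return_inj h Gn.2).
have r0 x : (r x > 0)%N -> G (r x) x.
  by rewrite /r; case: xgetP => //.
have mr : int_measurable (fun x => (r x)%:Z).
  move=> k.
  rewrite (_ : [set x | _] =
     [set x | exists n, (G n `&` [set _ | n%:Z = k]) x] `|`
     ([set x | forall n, (~` G n) x] `&` [set _ | 0 = k])).
    apply: measurableU.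
      by apply: measurable_exists => n; apply: measurableI => //; exact: measurable_Prop.
    apply: measurableI; last exact: measurable_Prop.
    by apply: measurable_forall => n; exact: measurableC.
  apply/seteqP; split => x /=.
    case: (pselect (exists n, G n x)) => [[n Gn]|nG].
      by rewrite (rG _ _ Gn) => <-; left; exists n.
    rewrite /r xgetPN; last by move=> n Gn; apply: nG; exists n.
    by move=> <-; right; split => // n Gn; apply: nG; exists n.
  move=> [[n [/rG-> //]]|[nG <-]].
  by rewrite /r xgetPN.
apply/L1_full_groupP; exists (fun x => (r x)%:Z); split => //.
  apply: filterS UA => x [UA UnA].
  case: (pselect (A x)) => [Ax|nAx].
    by have [n rn ->] := UA Ax; rewrite (rG n).
  by rewrite /r xgetPN ?UnA// => n [].
(* Kac's bound: the sets T^k {k < r} are disjoint, because T^k x = T^l y with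
   k < l would make l - k a return time of y smaller than r y. *)
rewrite /int_integrable integral_tail//; apply: le_lt_trans (ltry 1).
apply: (@tower_sum _ _ _ _ T) => [k|k l x y kl].
  exact: (int_measurable_pred (fun n => k%:Z < `|n|) mr).
rewrite /mkset => kx ly xy; have [Ax _] := r0 x ltac:(lia).
have [_ [_ _ /(_ (l - k)%N)]] := r0 y ltac:(lia).
apply; first lia.
suff -> : iter (l - k) T y = x by [].
apply: (can_inj (mp_powN T k)); rewrite xy -[iter _ _ _]/(mp_pow T (l - k)%N y) -mp_powD.
by congr mp_pow; lia.
Qed.

End induced.

(** * Visits under an ergodic transformation *)

Section ergodic.
Context (R : realType) d (X : measurableType d) (mu : probability X R).
Implicit Types (T U : Aut mu) (A : set X).

Lemma ergodic_visits T A : ergodic T -> measurable A -> (0 < mu A)%E ->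
  {ae mu, forall x, exists n, A (mp_pow T n x)}.
Proof.
move=> ergT mA A0; pose S := [set x | exists n, A (mp_pow T n x)].
have mS : measurable S.
  by apply: measurable_exists => n; exact: measurable_mp_pow_preimage.
have : mu S = 0%E \/ mu S = 1%E.
  apply: ergT => // x [n Anx] _ [m _ <-]; exists (n - m).
  by rewrite -mp_powD subrK.
case=> [S0|S1]; last exact: full_ae.
have AS : A `<=` S by move=> x Ax; exists 0.
by move: A0; rewrite (subset_measure0 mA mS AS S0) ltxx.
Qed.

Lemma ae_return (T : mpbij mu) A : measurable A ->
  {ae mu, forall x n, A (mp_pow T n x) -> exists2 m, n < m & A (mp_pow T m x)}.
Proof.
move=> mA.
have : {ae mu, forall x, A x -> exists n : nat, A (mp_pow T n.+1 x)}.
  have mW : measurable (A `&` [set x | forall n : nat, ~ A (mp_pow T n.+1 x)]).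
    apply: measurableI => //; apply: measurable_forall => n; apply: measurableC.
    exact: measurable_mp_pow_preimage.
  apply: filterS (null_ae_not mW (null_last_visit T mA)) => x h Ax.
  by apply: contrapT => /forallNP nA; exact: h.
move=> /(ae_mp_pow T); apply: filterS => x h n /h[m].
by rewrite -mp_powD => Am; exists (m.+1%:Z + n) => //; lia.
Qed.

Lemma mp_pow_sym (T : mpbij mu) n : mp_pow (mp_sym T) n = mp_pow T (- n).
Proof. by case: n => [[|n]|n]. Qed.

Lemma ae_two_sided_visits T A : ergodic T -> measurable A -> (0 < mu A)%E ->
  {ae mu, forall x k, (exists2 p, p <= k & A (mp_pow T p x)) /\
                      (exists2 q, k < q & A (mp_pow T q x))}.
Proof.
move=> ergT mA A0.
apply: filterS2 (ergodic_visits ergT mA A0) (filterI (ae_return T mA) (ae_return (mp_sym T) mA)).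
move=> x [n An] [fwd bwd] k.
have fwdN (N : nat) : exists2 q, n + N%:Z <= q & A (mp_pow T q x).
  elim: N => [|N [q nq /fwd[m qm Am]]]; first by exists n => //; rewrite addr0.
  by exists m => //; lia.
have bwdN (N : nat) : exists2 p, p <= n - N%:Z & A (mp_pow T p x).
  elim: N => [|N [p pn Ap]]; first by exists n => //; rewrite subr0.
  have /(_ _)[|m pm] := bwd (- p); first by rewrite mp_pow_sym opprK.
  by rewrite mp_pow_sym => Am; exists (- m) => //; lia.
split.
  have [p pn Ap] := bwdN (`|n - k|)%N; exists p => //; lia.
have [q nq Aq] := fwdN (`|k - n|.+1)%N; exists q => //; lia.
Qed.

End ergodic.

(** * Separation of points *)

Section separation.
Context (R : realType) d (X : measurableType d).

Definition separating (E : nat -> set X) : Prop :=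
  (forall n, measurable (E n)) /\ forall x y, x <> y -> exists n, E n x /\ ~ E n y.

(** Balls of small radius around a countable dense set separate points. *)
Lemma standard_Borel_separating : standard_Borel R X -> exists E, separating E.
Proof.
move=> [P [_ [D cD dD] [g bg mg]]].
have [h hinj] : exists h : P -> nat, {in D &, injective h}.
  exact/countable_injP.
pose E0 (mk : nat * nat) : set P :=
  [set y | exists2 c, D c /\ h c = mk.1 & (ball c (2 / mk.2.+1%:R))° y].
have oE0 mk : open (E0 mk).
  rewrite (_ : E0 mk = \bigcup_(c in [set c | D c /\ h c = mk.1]) (ball c (2 / mk.2.+1%:R))°).
    by apply: bigcup_open => c _; exact: open_interior.
  by apply/seteqP; split => y [c Dc By]; exists c.
pose E n : set X := if unpickle n is Some mk then g @^-1` E0 mk else set0.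
exists E; split=> [n|x y xy].
  rewrite /E; case: unpickle => [mk|//]; apply/mg; rewrite image_preimage.
    exact: sub_sigma_algebra.
  by apply/seteqP; split => // z _; have [g' _ gK] := bg; exists (g' z).
have r0 : 0 < mdist (g x) (g y).
  by rewrite mdist_gt0; apply/eqP => /(bij_inj bg).
set r := mdist _ _ in r0.
have [k kr] : exists k : nat, 3 / k.+1%:R < r.
  exists (Num.truncn (3 / r)); rewrite ltr_pdivrMr// mulrC -ltr_pdivrMr//.
  exact: truncnS_gt.
have k0 : 0 < k.+1%:R^-1 :> R by rewrite invr_gt0.
have [|c [Bc Dc]] := dD (ball (g x) k.+1%:R^-1)° _ (open_interior _).
  by exists (g x); exact: nbhsx_ballx.
have {}Bc := interior_subset Bc.
exists (pickle (h c, k)); rewrite /E pickleK; split.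
  exists c => //=; rewrite /interior.
  apply: filterS (nbhsx_ballx (g x) _ k0) => z xz.
  rewrite -[2]/(1 + 1 : R) mulrDl mul1r.
  by apply: ball_triangle xz; exact: ball_sym.
move=> /= [c' [Dc' hc'] /interior_subset c'y].
have {}c'E : c' = c by apply: hinj => //; rewrite inE.
rewrite {}c'E in c'y.
have := ball_triangle Bc c'y; rewrite ballEmdist /= -/r.
rewrite -[X in X + _]mul1r -mulrDl (_ : 1 + 2 = 3) => [ry|]; last by rewrite -(natrD R 1 2).
by have := lt_trans ry kr; rewrite ltxx.
Qed.

Variable E : nat -> set X.
Hypothesis sepE : separating E.

Lemma measurable_neq (f g : X -> X) : measurable_fun setT f ->
  measurable_fun setT g -> measurable [set x | f x <> g x].
Proof.
move=> mf mg; have [mE sE] := sepE.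
rewrite (_ : mkset _ = [set x | exists n, ((f @^-1` E n) `&` ~` (g @^-1` E n)) x]).
  apply: measurable_exists => n; apply: measurableI; last apply: measurableC;
    exact: measurable_preimageT.
apply/seteqP; split => x /=; first by move/sE.
by move=> [n [Ef nEg]] fg; apply: nEg; rewrite -fg.
Qed.

(** If f moves x, some separating set contains x but not f x; countably many
    choices cover A, so one of them meets A in positive measure. *)
Lemma pos_disjoint_piece (mu : probability X R) (f : X -> X) A :
  measurable_fun setT f -> measurable A -> (0 < mu A)%E ->
  {ae mu, forall x, f x <> x} ->
  exists B, [/\ measurable B, B `<=` A, (0 < mu B)%E & forall x, B x -> ~ B (f x)].
Proof.
move=> mf mA A0 fx; have [mE sE] := sepE.
have mF n : measurable (E n `&` ~` (f @^-1` E n)).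
  by apply: measurableI => //; apply: measurableC; exact: measurable_preimageT.
have [|n n0] := pos_exists mA mF A0.
  by apply: filterS fx => x fx _; have [n] := sE x (f x) (nesym fx); exists n.
exists (A `&` (E n `&` ~` (f @^-1` E n))); split => //; first exact: measurableI.
by move=> x [_ [_ nE]] [_ [Ef _]].
Qed.

End separation.

(** * Finite and free orbits *)

Section finite_orbits.
Context (R : realType) d (X : measurableType d) (mu : probability X R).
Implicit Types (T U : Aut mu) (A : set X).

Definition returning (T : mpbij mu) : set X := [set x | exists n : nat, mp_pow T n.+1 x = x].

Lemma returning_inv (T : mpbij mu) x n : returning T x -> returning T (mp_pow T n x).
Proof.
move=> [m mx]; exists m; rewrite -mp_powD addrC mp_powD mx//.
Qed.

(** A point that never returns to itself parametrizes its orbit by Z. *)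
Lemma mp_pow_inj (T : mpbij mu) x : ~ returning T x -> injective (mp_pow T ^~ x).
Proof.
move=> nr.
have ltF n m : n < m -> mp_pow T n x <> mp_pow T m x.
  move=> nm e; apply: nr; exists (absz (m - n)).-1.
  apply: (can_inj (mp_powN T n)); rewrite e -mp_powD; congr mp_pow; lia.
move=> n m /= e; case: (ltgtP n m) => // /ltF; [|move=> h; case: h]; by rewrite ?e.
Qed.

Lemma returning_finite_orbit (T : mpbij mu) x : returning T x -> finite_set (orbitz T x).
Proof.
move=> [m mx].
have per (n : int) : mp_pow T (n * m.+1%:Z) x = x.
  elim/int_ind: n => [|n IH|n IH]; first by rewrite mul0r.
    by rewrite (_ : n.+1%:Z * _ = m.+1%:Z + n%:Z * m.+1%:Z) ?mp_powD ?IH//; lia.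
  apply: (can_inj (mp_powN T m.+1)); rewrite mx -mp_powD -[RHS]IH; congr mp_pow; lia.
apply: (@sub_finite_set _ _ ((fun k : nat => mp_pow T k x) @` `I_m.+1)).
  move=> _ [n _ <-]; have -> : mp_pow T n x = mp_pow T (absz (n %% m.+1%:Z)%Z) x.
    rewrite {1}(divz_eq n m.+1) addrC mp_powD per; congr mp_pow; lia.
  by exists (absz (n %% m.+1%:Z)%Z) => //=; lia.
exact/finite_image/finite_II.
Qed.

(** The set of returning points is invariant; it is measurable because the
    diagonal is, thanks to the separating family. *)
Lemma finite_orbit_or_free E T : @separating d X E -> ergodic T ->
  {ae mu, forall x, finite_set (orbitz T x)} \/ {ae mu, forall x, ~ returning T x}.
Proof.
move=> sE ergT.
have mr : measurable (returning T).
  apply: measurable_exists => n.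
  rewrite (_ : (fun x => _ = x) = ~` [set x | mp_pow T n.+1 x <> x]).
    apply: measurableC; apply: (measurable_neq sE); [exact: measurable_mp_pow|exact: measurable_id].
  by apply/seteqP; split => x /= e; [move=> h; exact: h|exact: contrapT].
case: (ergT _ mr) => [x rx _ [n _ <-]|r0|r1]; first exact: returning_inv.
  by right; exact: null_ae_not.
by left; apply: filterS (full_ae mr r1) => x; exact: returning_finite_orbit.
Qed.

(** For the inverse: y lies in the T-orbit of U^-1 y, and lying in the same
    T-orbit is a symmetric relation. *)
Lemma ae_full_group_invariant T U : full_group T U ->
  {ae mu, forall x n, orbitz T x (U (mp_pow T n x)) /\ orbitz T x (mp_inv U (mp_pow T n x))}.
Proof.
move=> UT; have VT := ae_mp_comp (mp_sym U) UT.
apply: filterS2 (ae_mp_pow T UT) (ae_mp_pow T VT) => x h1 h2 n.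
have xn := orbitz_pow T n x; split; first exact: orbitz_trans xn (h1 n).
apply: orbitz_trans xn _; apply: orbitz_sym.
by have := h2 n; rewrite /= mp_invK.
Qed.

Lemma orbitz_sub T U : full_group T U ->
  {ae mu, forall x, orbitz U x `<=` orbitz T x}.
Proof.
move=> /ae_full_group_invariant; apply: filterS => x h _ [n _ <-].
elim/int_ind: n => [|n [m _ mx]|n [m _ mx]]; first by exists 0.
- by rewrite -addn1 PoszD mp_powS -mx; have [] := h m.
- rewrite (_ : mp_pow U _ x = mp_inv U (mp_pow U (- n%:Z) x)); last first.
    apply: (can_inj (mp_funK U)); rewrite mp_invK -mp_powS; congr mp_pow; lia.
  by rewrite -mx; have [] := h m.
Qed.

End finite_orbits.

(** * Cuts along the orbits *)

Section cuts.
Context (R : realType) d (X : measurableType d) (mu : probability X R).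
Implicit Types (c : X -> int).

(** Borel-Cantelli: the measure of {n < |c o T^(n+1)|} is that of {n < |c|},
    and these are the tails of an integrable function. *)
Lemma ae_sublinear (T : mpbij mu) c : int_measurable c -> int_integrable mu c ->
  {ae mu, forall x, exists N, forall n, (N <= n)%N -> `|c (mp_pow T n.+1 x)| <= n%:Z}.
Proof.
move=> mc ic; pose E n := [set x | n%:Z < `|c x|].
have mE n : measurable (E n) by exact: (int_measurable_pred (fun k => n%:Z < `|k|)).
pose F n := mp_pow T n.+1 @^-1` E n.
have mF n : measurable (F n) by exact: measurable_mp_pow_preimage.
have F0 : mu (lim_sup_set F) = 0%E.
  apply: lim_sup_set_cvg0 => //; move: ic; rewrite /int_integrable integral_tail//.
  by congr (_ < _)%E; apply: eq_eseriesr => n _; apply: esym; exact: mp_pow_preserving.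
have mL : measurable (lim_sup_set F).
  by apply: bigcap_measurable => // n _; exact: bigcup_measurable.
apply: filterS (null_ae_not mL F0) => x nx.
apply: contrapT => /forallNP h; apply: nx => N _.
have /existsNP[n /not_implyP[Nn /negP]] := h N.
by rewrite -ltNge => En; exists n.
Qed.

(** Applied to T and to its inverse, the Borel-Cantelli bound leaves
    k + c(T^k x) on the side of 0 where k is. *)
Lemma ae_finite_crossings (T : mpbij mu) c : int_measurable c -> int_integrable mu c ->
  {ae mu, forall x, exists b, forall k, k \notin window b ->
     (k + c (mp_pow T k x) < 0) = (k < 0)}.
Proof.
move=> mc ic; apply: filterS2 (ae_sublinear T mc ic) (ae_sublinear (mp_sym T) mc ic).
move=> x [N1 h1] [N2 h2]; exists (maxn N1 N2).+1 => k; rewrite mem_window => kb.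
have [k0|k0] := ltP k 0.
  have := h2 (absz k).-1 ltac:(lia); rewrite mp_pow_sym prednK; last by lia.
  rewrite (_ : - (absz k)%:Z = k); lia.
have := h1 (absz k).-1 ltac:(lia); rewrite prednK; last by lia.
rewrite (_ : (absz k)%:Z = k); lia.
Qed.

(** On a free orbit, n + c(T^n x) is the position of U (T^n x), and U
    permutes the orbit. *)
Lemma free_orbit_bijective (T : mpbij mu) (U : mpbij mu) c x : ~ returning T x ->
  (forall n, U (mp_pow T n x) = mp_pow T (c (mp_pow T n x)) (mp_pow T n x)) ->
  (forall n, orbitz T x (mp_inv U (mp_pow T n x))) ->
  bijective (fun n => n + c (mp_pow T n x)).
Proof.
move=> /mp_pow_inj inj Uc Vx; set s := fun n => _.
have sE n : U (mp_pow T n x) = mp_pow T (s n) x by rewrite Uc -mp_powD addrC.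
have sI : injective s.
  by move=> n m e; apply: inj; apply: (can_inj (mp_funK U)); rewrite !sE e.
have /choice[t tK] : forall n, exists m, s m = n.
  move=> n; have [m _ mE] := Vx n; exists m.
  by apply: inj; rewrite /= -sE mE mp_invK.
by exists t => // n; apply: sI; rewrite tK.
Qed.

Lemma measure_int_partition (C : int -> set X) S : (forall n, measurable (C n)) ->
  measurable S -> (forall x, exists n, C n x) ->
  (forall x n m, C n x -> C m x -> n = m) ->
  mu S = (\sum_(0 <= k <oo) oapp (fun n => mu (S `&` C n)) 0 (pickle_inv k))%E.
Proof.
move=> mC mS covC disC.
pose D k := oapp (fun n => S `&` C n) set0 (pickle_inv k).
have mD k : measurable (D k).
  by rewrite /D; case: pickle_inv => //= n; exact: measurableI.
have tD : trivIset setT D.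
  move=> k l _ _ [x []]; rewrite /D.
  have := pickle_invK (T := int) k; have := pickle_invK (T := int) l.
  case: pickle_inv => //= n <-; case: pickle_inv => //= m <- [_ Cn] [_ Cm].
  by rewrite (disC _ _ _ Cn Cm).
have SD : S = \bigcup_k D k.
  apply/seteqP; split => x; last by move=> [k _]; rewrite /D; case: pickle_inv => //= n [].
  move=> Sx; have [n Cn] := covC x; exists (pickle n) => //.
  by rewrite /D pickleK_inv.
rewrite [in LHS]SD measure_bigcup//.
rewrite (eq_eseriesl (Q := xpredT)) => [|k]; last by rewrite in_setT.
by apply: eq_eseriesr => k _; rewrite /D; case: pickle_inv => //=; rewrite measure0.
Qed.

(** On the piece where v = n the map is T^n; being an involution, it also maps
    the pieces onto the parts of a partition, indexed by the power T^n that
    leads into them. *)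
Lemma piecewise_power_preserving (T : mpbij mu) (v : X -> int) B :
  int_measurable v -> involutive (fun x => mp_pow T (v x) x) -> measurable B ->
  mu ((fun x => mp_pow T (v x) x) @^-1` B) = mu B.
Proof.
move=> mv VK mB; set V := fun x => _.
have mV : measurable (V @^-1` B).
  by apply: (measurable_glue (F := fun n => mp_pow T n @^-1` B)) => // n; exact: measurable_mp_pow_preimage.
have mvn n : measurable (mp_pow T (- n) @^-1` [set x | v x = n]).
  exact: measurable_mp_pow_preimage.
rewrite (measure_int_partition mv mV); first last.
- by move=> x n m /= <-.
- by move=> x; exists (v x).
rewrite [RHS](measure_int_partition mvn mB); first last.
- move=> x n m /= vn vm.
  have Vn : V (mp_pow T (- n) x) = x by rewrite /V vn mp_powNK.
  have Vm : V (mp_pow T (- m) x) = x by rewrite /V vm mp_powNK.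
  by rewrite -vn -vm; congr v; apply: (inv_inj VK); rewrite -[LHS]/(V _) -[RHS]/(V _) Vn Vm.
- move=> x; exists (v (V x)) => /=; congr v.
  by apply: (can_inj (mp_powN T (v (V x)))); rewrite mp_powNK; exact/esym/(VK x).
apply: eq_eseriesr => k _; case: pickle_inv => //= n.
rewrite -(mp_pow_preserving T (- n)).
  congr (mu _); apply/seteqP; split => x /= [].
    by rewrite /V => + vn; rewrite vn mp_powNK.
  by move=> Bx vn; split => //; rewrite /V vn mp_powNK.
by apply: measurableI => //; exact: mv.
Qed.

Section involution.
Variables (T : mpbij mu) (p : seq int * seq int) (A : set X).
Hypotheses (mA : measurable A) (pp : pairing p).

(** The position of y relative to the cut, a point of A, whose pairing moves y.
    The default b lies outside window b, so the pairing fixes it and points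
    far from every cut do not move. *)
Definition offset (b : nat) (y : X) : int :=
  xget b%:Z [set k | k \in p.1 ++ p.2 /\ A (mp_pow T (- k) y)].

Variable b : nat.
Hypothesis pb : {subset p.1 ++ p.2 <= window b}.
Hypothesis sepA : forall x k, A x -> A (mp_pow T k x) -> (absz k <= b.*2)%N -> k = 0.

Definition displacement y : int := swap p (offset b y) - offset b y.

Lemma offset_cut x k : A x -> k \in p.1 ++ p.2 -> offset b (mp_pow T k x) = k.
Proof.
move=> Ax kp; rewrite /offset; case: xgetP => [m _ /= [mp Am]|/(_ k)]; last first.
  by case; split => //; rewrite mp_powN.
have : k - m = 0.
  apply: (sepA Ax); first by rewrite addrC mp_powD.
  by have := pb kp; have := pb mp; rewrite !mem_window; lia.
lia.
Qed.

Lemma offsetP y : (offset b y \in p.1 ++ p.2 /\ A (mp_pow T (- offset b y) y)) \/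
  swap p (offset b y) = offset b y.
Proof.
rewrite /offset; case: xgetP => [m _ /= h|_]; [by left|right].
by apply: swap_out; apply/negP => /pb; rewrite mem_window; lia.
Qed.

Lemma displacement_involutive : involutive (fun y => mp_pow T (displacement y) y).
Proof.
move=> y; have [[kp Ax]|e] := offsetP y; last first.
  by rewrite {2}/displacement e subrr /= /displacement e subrr.
set k := offset b y in kp Ax; set x := mp_pow T (- k) y in Ax.
have yE : y = mp_pow T k x by rewrite /x mp_powNK.
have swE j : j \in p.1 ++ p.2 -> mp_pow T (displacement (mp_pow T j x)) (mp_pow T j x) = mp_pow T (swap p j) x.
  by move=> jp; rewrite /displacement offset_cut// -mp_powD subrK.
by rewrite yE swE// swE ?swap_mem// swapK.
Qed.

Lemma offset_measurable : int_measurable (offset b).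
Proof.
move=> n; pose K k := [set y | k \in p.1 ++ p.2 /\ A (mp_pow T (- k) y)].
have mK k : measurable (K k).
  by apply: measurableI; [exact: measurable_Prop|exact: measurable_mp_pow_preimage].
have Koff k y : K k y -> offset b y = k.
  by move=> [kp Ay]; rewrite -(mp_powNK T k y) offset_cut.
rewrite (_ : mkset _ = K n `|` ([set y | forall k, (~` K k) y] `&` [set _ | b%:Z = n])).
  apply: measurableU => //; apply: measurableI; last exact: measurable_Prop.
  by apply: measurable_forall => k; exact: measurableC.
apply/seteqP; split => y /=.
  case: (pselect (exists k, K k y)) => [[k Kk]|nK].
    by rewrite (Koff _ _ Kk) => <-; left.
  rewrite /offset xgetPN; last by move=> k Kk; apply: nK; exists k.
  by move=> <-; right; split => // k Kk; apply: nK; exists k.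
move=> [/Koff//|[nK <-]]; rewrite /offset xgetPN// => k Kk; exact: (nK k).
Qed.

Lemma displacement_measurable : int_measurable displacement.
Proof.
by move=> n; exact: (int_measurable_pred (fun k => swap p k - k = n) offset_measurable).
Qed.

Lemma displacement_bounded y : `|displacement y| <= b.*2%:Z.
Proof.
rewrite /displacement; have [[kp _]|->] := offsetP y; last by rewrite subrr.
have := kp; rewrite -(swap_mem _ pp) => /pb; have := pb kp.
rewrite !mem_window; lia.
Qed.

Lemma displacement_map_measurable : measurable_fun setT (fun y => mp_pow T (displacement y) y).
Proof.
move=> _ B mB; rewrite setTI.
apply: (measurable_glue (F := fun n => mp_pow T n @^-1` B)); first exact: displacement_measurable.
by move=> n; exact: measurable_mp_pow_preimage.
Qed.

Definition cut_swap : mpbij mu :=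
  MPBij displacement_involutive displacement_involutive displacement_map_measurable displacement_map_measurable
    (fun B mB => piecewise_power_preserving displacement_measurable displacement_involutive mB).

(** The windows of different cuts are disjoint. Hence the swaps around the
    other cuts keep each point on its side of x and outside the window of x,
    and do not disturb the balance achieved by the pairing at x. *)
Lemma cut_swap_balanced c i x k : A x ->
  (forall j, (swap p j + c (mp_pow T (swap p j) x) < i) = (j < 0)) ->
  (k + displacement (mp_pow T k x) +
     c (cut_swap (mp_pow T k x)) < i) = (k < 0).
Proof.
move=> Ax bal; set k' := k + _.
have -> : cut_swap (mp_pow T k x) = mp_pow T k' x by rewrite /k' addrC mp_powD.
have [kp|kp] := boolP (k \in p.1 ++ p.2).
  by have -> : k' = swap p k by rewrite /k' /displacement offset_cut// addrC subrK.
suff [k'p k'0] : k' \notin p.1 ++ p.2 /\ (k' < 0) = (k < 0).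
  by have := bal k'; rewrite swap_out// => ->.
rewrite /k' /displacement; have [[]|->] := offsetP (mp_pow T k x); last by rewrite subrr addr0.
set m := offset _ _ => mp; rewrite -mp_powD => Am.
have far : ~ (absz (- m + k)%R <= b.*2)%N.
  by move=> /(sepA Ax Am) e; move: kp; rewrite (_ : k = m) ?mp//; lia.
have := pb mp; have := mp; rewrite -(swap_mem _ pp) => /pb; rewrite !mem_window => h1 h2.
split; last by lia.
by apply/negP => /pb; rewrite mem_window; lia.
Qed.

End involution.
End cuts.

(** * Decomposition into periodic transformations *)

Section group_sets.
Variables (gT : groupType) (H : set gT).
Hypothesis Hgrp : group_closed [pred x : gT | x \in H].

Lemma setgroupM x y : H x -> H y -> H (x * y)%g.
Proof. by have := group_closedM Hgrp (x := x) (y := y); rewrite !inE. Qed.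

Lemma setgroupV x : H x -> H (x^-1)%g.
Proof. by have := group_closedV Hgrp (x := x); rewrite !inE. Qed.

End group_sets.

Section periodicity.
Context (R : realType) d (X : measurableType d) (mu : probability X R).
Implicit Types (f g : mpbij mu) (x : X).

(** By injectivity a finite forward orbit is a cycle. *)
Lemma finite_forward_orbit f x (S : set X) : finite_set S ->
  (forall n : nat, S (iter n f x)) -> finite_set (orbitz f x).
Proof.
move=> Sfin Sf; apply: returning_finite_orbit; apply: contrapT => /mp_pow_inj inj.
apply: infinite_nat; rewrite (_ : setT = (fun n : nat => mp_pow f n x) @^-1` S).
  by apply: finite_preimage => // n m _ _ /inj [].
by apply/seteqP; split => n // _; exact: Sf.
Qed.

Lemma ae_eq_pow f g : {ae mu, forall x, f x = g x} ->
  {ae mu, forall x n, mp_pow f n x = mp_pow g n x}.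
Proof.
move=> /(ae_mp_pow g); apply: filterS => x fg n.
elim/int_ind: n => [|n IH|n IH] //.
  by rewrite -addn1 PoszD !mp_powS IH fg.
apply: (can_inj (mp_funK f)); rewrite fg -!mp_powS.
by rewrite (_ : - n.+1%:Z + 1 = - n%:Z)//; lia.
Qed.

Lemma periodic_ae_eq (U : Aut mu) f : {ae mu, forall x, U x = f x} ->
  {ae mu, forall x, finite_set (orbitz f x)} -> Defs.periodic U.
Proof.
move=> /ae_eq_pow; apply: filterS2 => x e.
by rewrite (_ : orbitz U x = orbitz f x)//; apply: eq_imagel => n _; exact: e.
Qed.

Lemma involutive_finite_orbit f x : involutive f -> finite_set (orbitz f x).
Proof.
move=> fK; apply: returning_finite_orbit; exists 1%N => /=; exact: fK.
Qed.

Lemma Aut_eqP (U V : Aut mu) : {ae mu, forall x, U x = V x} -> U = V.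
Proof.
move=> UV; rewrite -[U]reprK -[V]reprK; apply/Aut_piE; exact/asboolP.
Qed.

(** A map preserving both half orbits at every cut preserves the finite
    intervals between consecutive cuts. *)
Lemma finite_orbit_between_cuts (T W : mpbij mu) (e : X -> int) A x :
  (forall n, W (mp_pow T n x) = mp_pow T (n + e (mp_pow T n x)) x) ->
  (forall y k, A y -> (k + e (mp_pow T k y) < 0) = (k < 0)) ->
  (exists2 p, p <= 0 & A (mp_pow T p x)) -> (exists2 q, 0 < q & A (mp_pow T q x)) ->
  finite_set (orbitz W x).
Proof.
move=> We eA [p p0 Ap] [q q0 Aq].
have side r k : A (mp_pow T r x) -> (k + e (mp_pow T k x) < r) = (k < r).
  move=> Ar; have := eA _ (k - r) Ar; rewrite -mp_powD subrK; lia.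
apply: (@finite_forward_orbit _ _ ((fun k : nat => mp_pow T (p + k%:Z) x) @` `I_(absz (q - p)))).
  exact/finite_image/finite_II.
move=> n; suff [k [pk kq ->]] : exists k, [/\ p <= k, k < q & iter n W x = mp_pow T k x].
  exists (absz (k - p)); first by rewrite /=; lia.
  by congr mp_pow; lia.
elim: n => [|n [k [pk kq IH]]]; first by exists 0.
exists (k + e (mp_pow T k x)); split.
- have := side p k Ap; lia.
- by rewrite side.
- by rewrite iterS IH We.
Qed.

End periodicity.

Section decomposition.
Context (R : realType) d (X : measurableType d) (mu : probability X R).
Variable (E : nat -> set X) (T : Aut mu).
Hypotheses (sepE : separating E) (ergT : ergodic T).
Hypothesis freeT : {ae mu, forall x, ~ returning T x}.

(** The return times 1, ..., N are excluded one at a time, each on a smaller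
    set; negative times follow by exchanging the two points. *)
Lemma pos_separated A (N : nat) : measurable A -> (0 < mu A)%E ->
  exists B, [/\ measurable B, B `<=` A, (0 < mu B)%E &
    forall x k, B x -> B (mp_pow T k x) -> (absz k <= N)%N -> k = 0].
Proof.
move=> mA A0.
have [B [mB BA B0 sB]] : exists B, [/\ measurable B, B `<=` A, (0 < mu B)%E &
    forall x (n : nat), B x -> (0 < n <= N)%N -> ~ B (mp_pow T n x)].
  elim: N => [|N [B [mB BA B0 sB]]]; first by exists A; split => // x n _; lia.
  have freeN : {ae mu, forall x, mp_pow T N.+1 x <> x}.
    by apply: filterS freeT => x nr e; apply: nr; exists N.
  have [C [mC CB C0 sC]] := pos_disjoint_piece sepE (measurable_mp_pow T N.+1) mB B0 freeN.
  exists C; split => //; first exact: subset_trans BA.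
  move=> x n Cx /andP[n0]; rewrite leq_eqVlt => /orP[/eqP->|nN]; first exact: sC.
  by move=> /CB; apply: sB; [exact: CB|rewrite n0].
exists B; split => // x k Bx Bk kN; apply: contrapT => k0.
have [k1|k1] := ltP 0 k.
  apply: (sB x (absz k) Bx); first lia.
  by rewrite (_ : (absz k)%:Z = k)//; lia.
apply: (sB _ (absz k) Bk); first lia.
by rewrite -mp_powD (_ : _ + k = 0)//; lia.
Qed.

Definition pow_Aut (n : int) : Aut mu := \pi_(Aut mu)%qT (mp_powb T n).

Lemma pow_Aut_ae n : {ae mu, forall x, pow_Aut n x = mp_pow T n x}.
Proof. exact: (Aut_repr_pi (mp_powb T n)). Qed.

Lemma pow_Aut_L1 n : L1_full_group T (pow_Aut n).
Proof.
apply/L1_full_groupP; exists (fun=> n); split.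
- exact: int_measurable_cst.
- exact: pow_Aut_ae.
- by apply: (@int_integrable_bounded _ _ _ _ _ `|n|) => //; exact: int_measurable_cst.
Qed.

Lemma pow_Aut_generated (H : set (Aut mu)) n :
  group_closed [pred U : Aut mu | U \in H] -> H T -> H (pow_Aut n).
Proof.
move=> Hgrp HT; have HM := setgroupM Hgrp; have HV := setgroupV Hgrp.
elim/int_ind: n => [|n IH|n IH].
- rewrite (_ : pow_Aut 0 = 1%g); first by have [] := Hgrp; rewrite !inE.
  by apply: Aut_eqP; apply: filterS2 (pow_Aut_ae 0) (Aut_repr_pi (mp_id mu)) => x -> ->.
- rewrite (_ : pow_Aut _ = (T * pow_Aut n)%g); first exact: HM.
  apply: Aut_eqP; apply: filterS3 (pow_Aut_ae n.+1) (pow_Aut_ae n) (AutM_ae T (pow_Aut n)).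
  by move=> x -> e ->; rewrite e -mp_powS -PoszD addn1.
- rewrite (_ : pow_Aut _ = (T^-1 * pow_Aut (- n%:Z))%g); first by apply: HM => //; exact: HV.
  apply: Aut_eqP.
  apply: filterS2 (pow_Aut_ae (- n.+1%:Z)) (filterI (pow_Aut_ae (- n%:Z))
    (filterI (AutM_ae T^-1%g (pow_Aut (- n%:Z))) (ae_mp_comp (pow_Aut (- n%:Z)) (AutV_ae T)))).
  move=> x -> [e [-> ->]]; rewrite e; apply: (can_inj (mp_funK T)).
  by rewrite mp_invK -mp_powS; congr mp_pow; lia.
Qed.

(** V corrects, at every cut in A, the crossings made by T^-i U; what remains
    preserves the intervals between consecutive cuts. *)
Lemma periodic_decomposition U : L1_full_group T U ->
  exists i V W, [/\ Per_L1 T V, Per_L1 T W & U = (pow_Aut i * W * V)%g].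
Proof.
move=> UL1; have [UT _] := UL1; have /L1_full_groupP[c [mc Uc ic]] := UL1.
pose G (z : int * (seq int * seq int)) : set X :=
  [set x | pairing z.2 /\ forall k, (swap z.2 k + c (mp_pow T (swap z.2 k) x) < z.1) = (k < 0)].
have mG z : measurable (G z).
  apply: measurableI; first exact: measurable_Prop.
  apply: measurable_forall => k.
  apply: (int_measurable_pred (fun n => (swap z.2 k + n < z.1) = (k < 0))).
  by apply: int_measurable_comp => //; exact: measurable_mp_pow.
have coverG : {ae mu, forall x, [set: X] x -> exists z, G z x}.
  apply: filterS3 (ae_finite_crossings T mc ic) (ae_mp_pow T Uc)
    (filterI freeT (ae_full_group_invariant UT)) => x [b cb] Ucx [fx Ux] _.
  have sbij := free_orbit_bijective fx Ucx (fun n => (Ux n).2).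
  have [i [p [pp bal]]] := balanced_cut sbij cb.
  by exists (i, p).
have [|[i p] G0] := pos_exists (@measurableT _ X) mG _ coverG.
  by rewrite probability_setT.
have [b pb] := seq_window (p.1 ++ p.2).
have mGz : measurable (setT `&` G (i, p)) by exact: measurableI.
have [A [mA AG A0 sA]] := pos_separated b.*2 mGz G0.
have [x0 /AG[_ [/= pp _]]] : A !=set0.
  by apply/set0P/negP => /eqP A00; rewrite A00 measure0 ltxx in A0.
pose v := displacement T p A b.
pose Vf := cut_swap mA pp pb sA.
pose V : Aut mu := \pi_(Aut mu)%qT Vf.
have VE : {ae mu, forall x, V x = Vf x} by exact: Aut_repr_pi.
have mv : int_measurable v by exact: displacement_measurable.
have VL1 : L1_full_group T V.
  apply/L1_full_groupP; exists v; split => //.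
  by apply: int_integrable_bounded => //; exact: displacement_bounded.
have VP : Defs.periodic V.
  apply: periodic_ae_eq VE _; apply: aeW => x.
  by apply: involutive_finite_orbit; exact: displacement_involutive.
have VV1 : (V * V = 1)%g.
  apply: Aut_eqP; apply: filterS3 (AutM_ae V V) (ae_mp_comp V VE)
    (filterI VE (Aut_repr_pi (mp_id mu))) => x -> -> [-> ->].
  exact: displacement_involutive.
pose W : Aut mu := (pow_Aut (- i) * (U * V))%g.
have LM := setgroupM (L1_full_group_closed T).
have WL1 : L1_full_group T W by apply: (LM); [exact: pow_Aut_L1|exact: (LM)].
(* V is its own inverse. *)
exists i, V, W; split => //; last first.
  rewrite /W !mulgA -[(_ * V * V)%g]mulgA VV1 mulg1.
  rewrite (_ : (pow_Aut i * pow_Aut (- i))%g = 1%g) ?mul1g//.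
  apply: Aut_eqP; apply: filterS3 (AutM_ae (pow_Aut i) (pow_Aut (- i)))
    (ae_mp_comp (pow_Aut (- i)) (pow_Aut_ae i))
    (filterI (pow_Aut_ae (- i)) (Aut_repr_pi (mp_id mu))) => x -> -> [-> ->].
  exact: mp_powNK.
split => //; rewrite /Defs.periodic.
have WE : {ae mu, forall x, W x = mp_pow T (- i) (mp_pow T (c (Vf x)) (Vf x))}.
  have h1 := AutM_ae (pow_Aut (- i)) (U * V)%g.
  have h2 := ae_mp_comp ((U * V)%g : Aut mu) (pow_Aut_ae (- i)).
  have h3 := AutM_ae U V.
  have h4 := ae_mp_comp V Uc.
  apply: filterS2 h1 (filterI (filterI h2 h3) (filterI VE h4)) => x -> [[-> ->] [Vx ->]].
  by rewrite Vx.
pose e y := v y + c (Vf y) - i.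
apply: filterS2 (ae_mp_pow T WE) (ae_two_sided_visits ergT mA A0) => x Wx vis.
have [past future] := vis 0.
apply: (finite_orbit_between_cuts (e := e)) past future => [n|y k Ay].
  rewrite Wx /= -!mp_powD /e; congr mp_pow; rewrite -/v.
  set a := v _; rewrite (_ : - i + _ + a + n = n + (a + c (mp_pow T (a + n) x) - i)); first by rewrite mp_powD.
  by rewrite addrAC addrC addrA; lia.
have [_ [_ bal]] := AG _ Ay.
have := cut_swap_balanced mA pp pb sA k Ay bal; rewrite -/v -/Vf /e => <-.
by rewrite /= !addrA subr_lt0.
Qed.

End decomposition.

Lemma Ind_L1_self (R : realType) d (X : measurableType d) (mu : probability X R)
  (T : Aut mu) : Ind_L1 T T.
Proof.
exists setT; split => //; first by rewrite probability_setT.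
apply: aeW => x; split; last by move=> [].
  by move=> _; exists 1%N => //; split => // m; lia.
Qed.

Theorem theorem4p18 (R : realType) (d : measure_display)
  (X : measurableType d) (mu : probability X R)
  (X_standard : standard_Borel R X) (mu_atomless : atomless mu)
  (T : Aut mu) (T_ergodic : ergodic T) :
  generated_subgroup (Per_L1 T `|` Ind_L1 T) = L1_full_group T.
Proof.
apply/seteqP; split => U.
  apply; split; first exact: L1_full_group_closed.
  by move=> V [[]//|]; exact: Ind_L1_sub.
move=> UL1 H [Hgrp HS].
have [E sepE] := standard_Borel_separating X_standard.
have [fin|free] := finite_orbit_or_free sepE T_ergodic.
  apply: HS; left; split => //; have [UT _] := UL1.
  by apply: filterS2 (orbitz_sub UT) fin => x; exact: sub_finite_set.
have [i [V [W [PV PW ->]]]] := periodic_decomposition sepE T_ergodic free UL1.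
have HM := setgroupM Hgrp.
have HT : H T by apply: HS; right; exact: Ind_L1_self.
by apply: (HM); [apply: (HM)|]; [exact: pow_Aut_generated|apply: HS; left..].
Qed.
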